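(* Let $\mathcal X$ and $\mathcal Y$ be the one-parameter families, with parameter $(A_0:A_1)$, of double octics $$X_{A_{0}:A_{1}}:\ u^{2}=(x - y)xy(y + t)(x + t)z\,(A_{0}x + A_{1}y + (-A_{0} + A_{1})z + A_{1}t)(z + t),$$ $$Y_{A_{0}:A_{1}}:\ u^{2}=xy(x + y)(A_{0}x + A_{1}y + A_{1}z)zt\,((-A_{0} + A_{1})x + A_{1}y + A_{1}t)(x + y + z + t).$$ The following map is birational: $$\mathcal X\ni(x,y,z,t,u,A_0,A_1)\longmapsto (x',y',z',t',u',A_0,A_0-A_1)\in\mathcal Y,$$ where $$x'=-(y-z)(x-y)x(A_{0}-A_{1}),$$ $$y'=-(x-y)\bigl((A_{0}-A_{1})xz-(A_{0}-A_{1})yz+A_{1}ty+A_{1}y^2\bigr),$$ $$z'=(y-z)(x-y)\bigl(A_{0}x-(A_{0}-A_{1})z+A_{1}t+A_{1}y\bigr),$$ $$t'=(x+t)\bigl(A_{0}xz-A_{0}yz+A_{1}ty-A_{1}xy+A_{1}y^2+A_{1}yz\bigr),$$ $$u'=(A_{0}-A_{1})\Bigl(\frac{A_{0}-A_{1}}{A_0}\Bigr)^{1/2}(A_{0}x-A_{0}z+A_{1}t-A_{1}x+A_{1}y+A_{1}z)(x-y)^2(y-z)$$ $$\qquad\cdot(A_{0}xz-A_{0}yz+A_{1}ty-A_{1}xz+A_{1}y^2+A_{1}yz)(A_{0}xz-A_{0}yz+A_{1}ty-A_{1}xy+A_{1}y^2+A_{1}yz)\,u.$$ The inverse birational map is given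 by $$(x,y,z,t,u,A_0,A_1)\longmapsto(x'',y'',z'',t'',u'',A_0,A_0-A_1),$$ where, with $$B=A_{0}^2xy-A_{0}A_{1}tx-A_{0}A_{1}ty-A_{0}A_{1}x^2-3A_{0}A_{1}xy-A_{0}A_{1}xz-A_{0}A_{1}y^2+A_{1}^2tx+A_{1}^2ty+A_{1}^2x^2+3A_{1}^2xy+A_{1}^2xz+2A_{1}^2y^2+A_{1}^2yz,$$ $$S=A_{0}tx+A_{0}x^2+A_{0}xz-A_{1}tx-A_{1}x^2-A_{1}xy-A_{1}xz-A_{1}yz,$$ one has $$x''=xB,\qquad y''=-(x+y)A_{1}S,\qquad z''=-(A_{0}x+A_{1}y+A_{1}z)S,$$ $$t''=-A_{0}^2x^2y+A_{0}A_{1}tx^2+2A_{0}A_{1}txy+A_{0}A_{1}x^3+3A_{0}A_{1}x^2y+A_{0}A_{1}x^2z+A_{0}A_{1}xy^2-A_{1}^2tx^2-2A_{1}^2txy+A_{1}^2tyz-A_{1}^2x^3-3A_{1}^2x^2y-A_{1}^2x^2z-2A_{1}^2xy^2-A_{1}^2xyz,$$ $$u''=A_{1}\sqrt{A_0A_{1}}\;y\,(A_{0}x-A_{1}x+A_{1}z)^2\,S\,B\,(A_{0}x-A_{1}x-A_{1}y)\,u.$$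
   Context: The base field is $\mathbb{C}$. A double octic is a Calabi–Yau threefold obtained as a crepant resolution of the double cover of $\mathbb{P}^3$ branched along a union of eight planes (no six through a point, no four through a line); the double cover is given by an equation $u^2=\ell_1\cdots\ell_8$, with $\ell_i$ linear forms in $x,y,z,t$, in the weighted projective space $\mathbb{P}(1,1,1,1,4)$ with coordinates $(x:y:z:t:u)$. A point of the family $\mathcal X$ (resp. $\mathcal Y$) is written $(x,y,z,t,u,A_0,A_1)$, where $(x:y:z:t:u)$ lies on $X_{A_0:A_1}$ (resp. $Y_{A_0:A_1}$); thus the maps send the member with parameter $(A_0:A_1)$ of one family to the member with parameter $(A_0:A_0-A_1)$ of the other.
   Formalization: Members are taken at the representative (1 : A1/A0), since the printed u', u'' are off by a factor A0^{±1/2} otherwise; the families are pulled back to the double cover of the parameter line where the root is single-valued, omitting A0=0 and, for X, A0=A1 (for Y, A1=0). *)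

(* Defs.v *)
From mathcomp Require Import all_boot all_order all_algebra.
From mathcomp Require Export complex mpoly reals.

Set Implicit Arguments.
Unset Strict Implicit.
Unset Printing Implicit Defensive.

Import GRing.Theory.
Local Open Scope ring_scope.

(* Multigraded coordinates.  A weight table [W : 'I_k -> 'I_n -> nat] gives n
   coordinates degrees in Z^k; the k-dimensional torus acts on n-tuples, and a point
   of the corresponding (weighted, multi-)projective space is an n-tuple up to
   [same_point].  Subvarieties are predicates on n-tuples that are stable under
   the action and avoid the irrelevant locus. *)
Section WeightedProjective.

Variable F : fieldType.

Definition weights (k n : nat) := 'I_k -> 'I_n -> nat.

Definition same_point k n (W : weights k n) (v w : n.-tuple F) : Prop :=
  exists c : 'I_k -> F, (forall j, c j != 0) /\
    (forall i, tnth w i = (\prod_j c j ^+ W j i) * tnth v i).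

Definition multihomog k n (W : weights k n) (p : {mpoly F[n]}) : Prop :=
  exists d : 'I_k -> nat, forall m : 'X_{1..n}, m \in msupp p ->
    forall j, (\sum_i W j i * m i)%N = d j.

Definition zariski_closed k n (W : weights k n) (Z : n.-tuple F -> Prop) : Prop :=
  exists S : {mpoly F[n]} -> Prop,
    (forall p, S p -> multihomog W p) /\
    (forall v, Z v <-> forall p, S p -> p.@[tnth v] = 0).

Definition open_in k n (W : weights k n) (U V : n.-tuple F -> Prop) : Prop :=
  exists2 Z, zariski_closed W Z & forall v, U v <-> V v /\ ~ Z v.

Definition dense_in k n (W : weights k n) (U V : n.-tuple F -> Prop) : Prop :=
  forall Z, zariski_closed W Z ->
    (forall v, U v -> Z v) -> (forall v, V v -> Z v).

(* [f] acts on homogeneous coordinates; it induces a morphism on [U] when it is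
   compatible with [same_point] and its value is given, near every point of
   [U], by quotients of multihomogeneous polynomials. *)
Definition regular_on k n l m (W : weights k n) (W' : weights l m)
    (U : n.-tuple F -> Prop) (f : n.-tuple F -> m.-tuple F) : Prop :=
  (forall v w, U v -> U w -> same_point W v w -> same_point W' (f v) (f w)) /\
  (forall v, U v -> exists a b : 'I_m -> {mpoly F[n]},
     [/\ forall i, multihomog W (a i) /\ multihomog W (b i),
         forall i, (b i).@[tnth v] != 0
       & forall w, U w -> (forall i, (b i).@[tnth w] != 0) ->
           same_point W' (f w)
             [tuple (a i).@[tnth w] / (b i).@[tnth w] | i < m]]).

Definition birational_inverse k n l m (W : weights k n) (W' : weights l m)
    (V : n.-tuple F -> Prop) (V' : m.-tuple F -> Prop)
    (f : n.-tuple F -> m.-tuple F) (g : m.-tuple F -> n.-tuple F) : Prop :=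
  exists (U : n.-tuple F -> Prop) (U' : m.-tuple F -> Prop),
    [/\ open_in W U V /\ dense_in W U V,
        open_in W' U' V' /\ dense_in W' U' V',
        regular_on W W' U f /\ regular_on W' W U' g,
        forall v, U v -> U' (f v) /\ same_point W (g (f v)) v
      & forall w, U' w -> U (g w) /\ same_point W' (f (g w)) w].

Definition birational k n l m (W : weights k n) (W' : weights l m)
    (V : n.-tuple F -> Prop) (V' : m.-tuple F -> Prop)
    (f : n.-tuple F -> m.-tuple F) : Prop :=
  exists g, birational_inverse W W' V V' f g.

End WeightedProjective.

(* The ring is kept general so that the formulas make sense both for scalars
   and for polynomials.  Coordinates are (x, y, z, t, u). *)
Section Formulas.

Variable K : comNzRingType.
Implicit Type v : 5.-tuple K.

Definition octicX (A0 A1 : K) v : K :=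
  let x := v`_0 in let y := v`_1 in let z := v`_2 in let t := v`_3 in
  (x - y) * x * y * (y + t) * (x + t) * z
  * (A0 * x + A1 * y + (- A0 + A1) * z + A1 * t) * (z + t).

Definition octicY (A0 A1 : K) v : K :=
  let x := v`_0 in let y := v`_1 in let z := v`_2 in let t := v`_3 in
  x * y * (x + y) * (A0 * x + A1 * y + A1 * z) * z * t
  * ((- A0 + A1) * x + A1 * y + A1 * t) * (x + y + z + t).

(* [r] stands for ((A0 - A1) / A0)^(1/2) *)
Definition mapXY (A0 A1 r : K) v : 5.-tuple K :=
  let x := v`_0 in let y := v`_1 in let z := v`_2 in let t := v`_3 in
  let u := v`_4 in
  [tuple
     - (y - z) * (x - y) * x * (A0 - A1);
     - (x - y) * ((A0 - A1) * x * z - (A0 - A1) * y * z + A1 * t * y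
                  + A1 * y ^+ 2);
     (y - z) * (x - y) * (A0 * x - (A0 - A1) * z + A1 * t + A1 * y);
     (x + t) * (A0 * x * z - A0 * y * z + A1 * t * y - A1 * x * y
                + A1 * y ^+ 2 + A1 * y * z);
     (A0 - A1) * r
     * (A0 * x - A0 * z + A1 * t - A1 * x + A1 * y + A1 * z)
     * (x - y) ^+ 2 * (y - z)
     * (A0 * x * z - A0 * y * z + A1 * t * y - A1 * x * z + A1 * y ^+ 2
        + A1 * y * z)
     * (A0 * x * z - A0 * y * z + A1 * t * y - A1 * x * y + A1 * y ^+ 2
        + A1 * y * z)
     * u].

(* [s] stands for sqrt (A0 * A1) *)
Definition mapYX (A0 A1 s : K) v : 5.-tuple K :=
  let x := v`_0 in let y := v`_1 in let z := v`_2 in let t := v`_3 in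
  let u := v`_4 in
  let B := A0 ^+ 2 * x * y - A0 * A1 * t * x - A0 * A1 * t * y
    - A0 * A1 * x ^+ 2 - 3 * A0 * A1 * x * y - A0 * A1 * x * z
    - A0 * A1 * y ^+ 2 + A1 ^+ 2 * t * x + A1 ^+ 2 * t * y
    + A1 ^+ 2 * x ^+ 2 + 3 * A1 ^+ 2 * x * y + A1 ^+ 2 * x * z
    + 2 * A1 ^+ 2 * y ^+ 2 + A1 ^+ 2 * y * z in
  let S := A0 * t * x + A0 * x ^+ 2 + A0 * x * z - A1 * t * x
    - A1 * x ^+ 2 - A1 * x * y - A1 * x * z - A1 * y * z in
  [tuple
     x * B;
     - (x + y) * A1 * S;
     - (A0 * x + A1 * y + A1 * z) * S;
     - A0 ^+ 2 * x ^+ 2 * y + A0 * A1 * t * x ^+ 2 + 2 * A0 * A1 * t * x * y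
     + A0 * A1 * x ^+ 3 + 3 * A0 * A1 * x ^+ 2 * y + A0 * A1 * x ^+ 2 * z
     + A0 * A1 * x * y ^+ 2 - A1 ^+ 2 * t * x ^+ 2
     - 2 * A1 ^+ 2 * t * x * y + A1 ^+ 2 * t * y * z - A1 ^+ 2 * x ^+ 3
     - 3 * A1 ^+ 2 * x ^+ 2 * y - A1 ^+ 2 * x ^+ 2 * z
     - 2 * A1 ^+ 2 * x * y ^+ 2 - A1 ^+ 2 * x * y * z;
     A1 * s * y * (A0 * x - A1 * x + A1 * z) ^+ 2 * S * B
     * (A0 * x - A1 * x - A1 * y) * u].

End Formulas.

Section Families.

Variable F : fieldType.
Implicit Types (v : 5.-tuple F) (p : 8.-tuple F).

(* P(1,1,1,1,4) *)
Definition weights_fiber : weights 1 5 :=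
  fun _ i => nth 0%N [:: 1; 1; 1; 1; 4]%N i.

(* The octic forms have degree 1, resp. 2, in (A0, A1), so rescaling (A0, A1)
   twists u^2 by a constant.  The member over the point (A0 : A1) of the
   parameter line is therefore taken from the representative (1, A1 / A0); this
   is the normalization for which the formulas for u' and u'', which are
   homogeneous in (A0, A1), hold for every representative. *)
Definition fiberX (A0 A1 : F) v : Prop :=
  v != [tuple 0; 0; 0; 0; 0] /\ v`_4 ^+ 2 = octicX 1 (A1 / A0) v.

Definition fiberY (A0 A1 : F) v : Prop :=
  v != [tuple 0; 0; 0; 0; 0] /\ v`_4 ^+ 2 = octicY 1 (A1 / A0) v.

(* Total spaces: coordinates (x, y, z, t, u, A0, A1, r) in
   P(1,1,1,1,4) * P^1 * A^1, where r is a branch of the square root occurring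
   in the map, i.e. the families are pulled back to the double cover of the
   parameter line on which it is single-valued.  Left out are A0 = A1 for X (six
   planes meet in a point), A1 = 0 for Y (two planes coincide), and A0 = 0,
   where the root is not defined. *)
Definition weights_total : weights 2 8 :=
  fun j i => nth 0%N (nth [::] [:: [:: 1; 1; 1; 1; 4; 0; 0; 0];
                                   [:: 0; 0; 0; 0; 0; 1; 1; 0]]%N j) i.

Definition fiber_coords p : 5.-tuple F :=
  [tuple p`_0; p`_1; p`_2; p`_3; p`_4].

Definition total_point v (A0 A1 r : F) : 8.-tuple F :=
  [tuple v`_0; v`_1; v`_2; v`_3; v`_4; A0; A1; r].

Definition totalX p : Prop :=
  let A0 := p`_5 in let A1 := p`_6 in let r := p`_7 in
  [/\ A0 != 0, A1 != A0, r ^+ 2 = (A0 - A1) / A0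
    & fiberX A0 A1 (fiber_coords p)].

(* Here r ^+ 2 = A1 / A0, so that A0 * r is a square root of A0 * A1. *)
Definition totalY p : Prop :=
  let A0 := p`_5 in let A1 := p`_6 in let r := p`_7 in
  [/\ A0 != 0, A1 != 0, r ^+ 2 = A1 / A0
    & fiberY A0 A1 (fiber_coords p)].

Definition total_mapXY p : 8.-tuple F :=
  let A0 := p`_5 in let A1 := p`_6 in let r := p`_7 in
  total_point (mapXY A0 A1 r (fiber_coords p)) A0 (A0 - A1) r.

Definition total_mapYX p : 8.-tuple F :=
  let A0 := p`_5 in let A1 := p`_6 in let r := p`_7 in
  total_point (mapYX A0 A1 (A0 * r) (fiber_coords p)) A0 (A0 - A1) r.

End Families.

(* Main.v *)
Require Import Defs.
From mathcomp Require Import all_boot all_order all_algebra.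
From mathcomp Require Import ring zify.

(* Write f for the map X --> Y and g for the map Y --> X.  Pulling back by f any
   of the eight linear forms of the octic of Y, or one of the factors of the
   formulas for g, gives a product of linear forms of the octic of X and of
   three auxiliary forms L, Q, Q' (and likewise for g, with D, E, S, B).  Hence
   f maps X to Y, and g o f multiplies (x, y, z, t) by a single form c: both
   compositions are the identity as rational maps, and f, g restrict to inverse
   isomorphisms between the complements of c = 0 and of the analogous form d.
   These complements are dense in every fibre: if p(x, u) vanishes on
   u^2 = octic(x) outside of c = 0, apply this on a line through a given point to
   both square roots u and -u to see that the even and the odd part of p in u
   vanish along that line.  As c and d are nonzero on every allowed fibre, density
   in the total spaces follows from density in the fibres. *)

Set Implicit Arguments.
Unset Strict Implicit.
Unset Printing Implicit Defensive.

Import Order.TTheory GRing.Theory Num.Theory.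
Local Open Scope ring_scope.

(** * Polynomials homogeneous for one system of weights *)

Section WeightedHomogeneous.

Context {F : fieldType} {n : nat} {w : 'I_n -> nat}.
Implicit Types p q : {mpoly F[n]}.

(** One row of [multihomog] with its degree named, so that degrees can be computed by recursion on
    the expression of a polynomial. *)
Definition whomog (d : nat) p : Prop :=
  forall m : 'X_{1..n}, m \in msupp p -> (\sum_i w i * m i)%N = d.

Lemma whomogC c : whomog 0 c%:MP.
Proof.
move=> m; rewrite msuppC; case: eqP => //= _; rewrite inE => /eqP->.
by apply: big1 => i _; rewrite mnm0E muln0.
Qed.

Lemma whomogXi i : whomog (w i) 'X_i.
Proof.
move=> m; rewrite msuppX inE => /eqP->; rewrite (bigD1 i) //= big1 => [|j ji].
  by rewrite mnmE eqxx muln1 addn0.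
by rewrite mnmE eq_sym (negPf ji) muln0.
Qed.

Lemma whomogN d p : whomog d p -> whomog d (- p).
Proof. by move=> hp m; rewrite (perm_mem (msuppN p)) => /hp. Qed.

Lemma whomogD d p q : whomog d p -> whomog d q -> whomog d (p + q).
Proof. by move=> hp hq m /msuppD_le; rewrite mem_cat => /orP[/hp|/hq]. Qed.

Lemma whomogM d e p q : whomog d p -> whomog e q -> whomog (d + e) (p * q).
Proof.
move=> hp hq m /msuppM_le/allpairsP[[m1 m2] /= [/hp <- /hq <- ->]].
by rewrite -big_split; apply: eq_bigr => i _; rewrite /= mnmDE mulnDr.
Qed.

Lemma whomogX d p k : whomog d p -> whomog (d * k) (p ^+ k).
Proof.
move=> hp; elim: k => [|k IHk]; first by rewrite muln0 expr0 -mpolyC1; apply: whomogC.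
by rewrite exprS mulnS; apply: whomogM.
Qed.

Lemma whomog_nat k : whomog 0 k%:R.
Proof. by rewrite -(rmorph_nat (@mpolyC n F)); apply: whomogC. Qed.

Lemma whomog_eq d e p : whomog d p -> d = e -> whomog e p.
Proof. by move=> hp <-. Qed.

End WeightedHomogeneous.

Arguments whomog {F n} w d p.
Arguments whomogC {F n w} c.
Arguments whomogXi {F n w} i.

(** The degree is an existential variable, synthesized from the expression. Only a sum leaves an
    equation between degrees, solved by [lia]. Numerals such as [3] are matched in the form
    [1 *+ 3]. *)
Ltac whomog_rec :=
  lazymatch goal with
  | |- whomog _ _ (_ + _) =>
      eapply whomogD; [whomog_rec | eapply whomog_eq; [whomog_rec | lia]]
  | |- whomog _ _ (_ * _) => eapply whomogM; [whomog_rec | whomog_rec]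
  | |- whomog _ _ (- _) => eapply whomogN; whomog_rec
  | |- whomog _ _ (_ ^+ _) => eapply whomogX; whomog_rec
  | |- whomog _ _ (_ *+ _) => eapply whomog_nat
  | |- _ => eassumption
  end.
Ltac whomog_tac := eapply whomog_eq; [whomog_rec | lia].

(** All monomials of [p] are eigenvectors of the torus for one and the same character, given by the
    exponents [d]. *)
Lemma meval_torus {F : fieldType} {k n : nat} {W : weights k n} {d : 'I_k -> nat}
    {p : {mpoly F[n]}} (c : 'I_k -> F) (v : 'I_n -> F) :
  (forall j, whomog (W j) (d j) p) ->
  p.@[fun i => (\prod_j c j ^+ W j i) * v i] = (\prod_j c j ^+ d j) * p.@[v].
Proof.
move=> hp; rewrite !mevalE mulr_sumr; apply: eq_big_seq => m mp.
under eq_bigr do rewrite exprMn.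
rewrite big_split /= mulrCA; congr (_ * (_ * _)).
under eq_bigr do rewrite -prodrXl.
rewrite exchange_big /=; apply: eq_bigr => j _.
by rewrite -(hp j m mp) -prodrXr; apply: eq_bigr => i _; rewrite exprM.
Qed.

(** * Regular and birational maps given by polynomials *)

Section PolynomialMaps.

Variable F : fieldType.

Lemma same_point_sym {k n} (W : weights k n) (v w : n.-tuple F) :
  same_point W v w -> same_point W w v.
Proof.
case=> c [c0 cw]; exists (fun j => (c j)^-1); split=> [j|i].
  by rewrite invr_eq0.
rewrite cw; under eq_bigr do rewrite exprVn.
by rewrite prodfV mulKf //; apply/prodf_neq0 => j _; rewrite expf_neq0.
Qed.

Lemma eq_same_point {k n} (W : weights k n) (v w : n.-tuple F) :
  tnth v =1 tnth w -> same_point W v w.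
Proof.
move=> vw; exists (fun=> 1); split=> [_|i]; first exact: oner_neq0.
by rewrite big1 => [|j _]; rewrite ?expr1n // mul1r vw.
Qed.

(** The matrix [D] describes the homomorphism of tori that makes [f] equivariant: [c] goes to the
    element with coordinates [\prod_j c j ^+ D l j]. All denominators can be taken to be 1. *)
Lemma regular_on_poly {k n l m} (W : weights k n) (W' : weights l m)
    (U : n.-tuple F -> Prop) (f : n.-tuple F -> m.-tuple F)
    (P : 'I_m -> {mpoly F[n]}) (D : 'I_l -> 'I_k -> nat) :
  (forall v i, tnth (f v) i = (P i).@[tnth v]) ->
  (forall i j, whomog (W j) (\sum_l W' l i * D l j) (P i)) ->
  regular_on W W' U f.
Proof.
move=> fP hP; split=> [v w _ _ [c [c0 cw]]|v _].
  exists (fun l => \prod_j c j ^+ D l j); split=> [l0|i].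
    by apply/prodf_neq0 => j _; rewrite expf_neq0.
  rewrite !fP (meval_eq _ cw) (meval_torus c _ (hP i)); congr (_ * _).
  under eq_bigr do rewrite -prodrXr.
  rewrite exchange_big; apply: eq_bigr => l0 _ /=; rewrite -prodrXl.
  by apply: eq_bigr => j _; rewrite -exprM mulnC.
exists P, (fun=> 1); split=> [i|i|w _ _].
- split; first by exists (fun j => \sum_l W' l i * D l j)%N => q qP j; apply: hP.
  by exists (fun=> 0%N) => q qP j; exact: (whomog_nat (k := 1) qP).
- by rewrite meval1 oner_neq0.
by apply: eq_same_point => i; rewrite tnth_mktuple meval1 divr1 fP.
Qed.

Lemma open_in_neq0 {k n} (W : weights k n) (V : n.-tuple F -> Prop)
    (c : {mpoly F[n]}) :
  multihomog W c -> open_in W (fun v => V v /\ c.@[tnth v] != 0) V.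
Proof.
move=> hc; exists (fun v => c.@[tnth v] = 0); last first.
  by move=> v; split=> -[Vv /eqP].
exists (eq c); split=> [_ <-//|v]; split=> [c0 _ <-//|]; exact.
Qed.

(** The open sets are the loci where [c], resp. [d], does not vanish. What remains to be checked is
    degrees, density, and that the maps exchange these loci and are mutually inverse there. *)
Lemma birational_inverse_poly {k n l m} (W : weights k n) (W' : weights l m)
    (V : n.-tuple F -> Prop) (V' : m.-tuple F -> Prop)
    (f : n.-tuple F -> m.-tuple F) (g : m.-tuple F -> n.-tuple F)
    (P : 'I_m -> {mpoly F[n]}) (Q : 'I_n -> {mpoly F[m]})
    (D : 'I_l -> 'I_k -> nat) (D' : 'I_k -> 'I_l -> nat)
    (c : {mpoly F[n]}) (d : {mpoly F[m]}) :
  (forall v i, tnth (f v) i = (P i).@[tnth v]) ->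
  (forall v i, tnth (g v) i = (Q i).@[tnth v]) ->
  (forall i j, whomog (W j) (\sum_l W' l i * D l j) (P i)) ->
  (forall i j, whomog (W' j) (\sum_l W l i * D' l j) (Q i)) ->
  multihomog W c -> multihomog W' d ->
  dense_in W (fun v => V v /\ c.@[tnth v] != 0) V ->
  dense_in W' (fun v => V' v /\ d.@[tnth v] != 0) V' ->
  (forall v, V v -> c.@[tnth v] != 0 ->
     [/\ V' (f v), d.@[tnth (f v)] != 0 & same_point W v (g (f v))]) ->
  (forall v, V' v -> d.@[tnth v] != 0 ->
     [/\ V (g v), c.@[tnth (g v)] != 0 & same_point W' v (f (g v))]) ->
  birational_inverse W W' V V' f g.
Proof.
move=> fP gQ hP hQ hc hd Vdense V'dense VV' V'V.
exists (fun v => V v /\ c.@[tnth v] != 0), (fun v => V' v /\ d.@[tnth v] != 0).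
split.
- by split=> //; apply: open_in_neq0.
- by split=> //; apply: open_in_neq0.
- by split; [apply: (regular_on_poly _ fP hP)|apply: (regular_on_poly _ gQ hQ)].
- by move=> v [Vv cv]; have [? ? /same_point_sym] := VV' v Vv cv.
- by move=> v [Vv cv]; have [? ? /same_point_sym] := V'V v Vv cv.
Qed.

End PolynomialMaps.

(** * Density of a nonvanishing locus in a double cover *)

Section Density.

Variable F : numClosedFieldType.

Lemma rmorph_mmap {n} {A B C : comNzRingType} (g : {rmorphism B -> C})
    (e : A -> B) (h : 'I_n -> B) (p : {mpoly A[n]}) :
  g (mmap e h p) = mmap (g \o e) (g \o h) p.
Proof.
rewrite rmorph_sum; apply: eq_bigr => m _; rewrite rmorphM rmorph_prod /=.
by congr (_ * _); apply: eq_bigr => i _; rewrite rmorphXn.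
Qed.

Lemma horner_mmap {n} (h : 'I_n -> {poly F}) (p : {mpoly F[n]}) s :
  (mmap polyC h p).[s] = p.@[fun i => (h i).[s]].
Proof.
rewrite -horner_evalE rmorph_mmap; apply: eq_bigr => m _ /=.
by rewrite horner_evalE hornerC.
Qed.

Lemma poly_neq0_horner (p : {poly F}) : p != 0 -> exists s, p.[s] != 0.
Proof.
(* In characteristic 0 the first [size p] natural numbers are distinct, and they are more than [p]
   can have roots. *)
move=> p0; have /allPn[s _ ps] : ~~ all (root p) [seq i%:R | i <- iota 0 (size p)].
  apply: contraNN p0 => /roots_geq_poly_eq0-> //; last by rewrite size_map size_iota.
  by rewrite map_inj_uniq ?iota_uniq // => i j /eqP; rewrite eqr_nat => /eqP.
by exists s.
Qed.

Lemma poly_eq0_horner (p : {poly F}) : (forall s, p.[s] = 0) -> p = 0.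
Proof.
by move=> p0; have [//|/poly_neq0_horner[s]] := eqVneq p 0; rewrite p0 eqxx.
Qed.

Let line n (a b : 'I_n -> F) i : {poly F} := (a i)%:P + 'X * (b i - a i)%:P.

Let line0 n (a b : 'I_n -> F) : (fun i => (line a b i).[0]) =1 a.
Proof. by move=> i; rewrite !(hornerD, hornerM, hornerX, hornerC); ring. Qed.

Let line1 n (a b : 'I_n -> F) : (fun i => (line a b i).[1]) =1 b.
Proof. by move=> i; rewrite !(hornerD, hornerM, hornerX, hornerC); ring. Qed.

(** On the line through [a] and [b] both polynomials restrict to nonzero polynomials in one
    variable, and so does their product. *)
Lemma common_nonzero {n} (f h : {mpoly F[n]}) (a b : 'I_n -> F) :
  f.@[a] != 0 -> h.@[b] != 0 -> exists c, f.@[c] != 0 /\ h.@[c] != 0.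
Proof.
move=> fa hb; pose w := line a b.
have w0 := line0 a b : (fun i => (w i).[0]) =1 a.
have w1 := line1 a b : (fun i => (w i).[1]) =1 b.
have f0 : mmap polyC w f != 0.
  by apply: contraNneq fa => f0; rewrite -(meval_eq f w0) -horner_mmap f0 horner0.
have h0 : mmap polyC w h != 0.
  by apply: contraNneq hb => h0; rewrite -(meval_eq h w1) -horner_mmap h0 horner0.
have [s] := poly_neq0_horner (mulf_neq0 f0 h0).
by rewrite hornerM mulf_eq0 negb_or !horner_mmap => /andP; exists (fun i => (w i).[s]).
Qed.

(* For every [s] both square roots [u] and [- u] of [f.[s]] satisfy the
   hypothesis, so the even and the odd part of [p] vanish separately at [f]. *)
Lemma vanish_double_cover1 (f h : {poly F}) (p : {poly {poly F}}) :
  f != 0 -> h != 0 ->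
  (forall s u, u ^+ 2 = f.[s] -> h.[s] != 0 -> p.[u%:P].[s] = 0) ->
  forall s u, u ^+ 2 = f.[s] -> p.[u%:P].[s] = 0.
Proof.
move=> f0 h0 p0.
pose e := (even_poly p).[f]; pose o := (odd_poly p).[f].
have pE s u : u ^+ 2 = f.[s] -> p.[u%:P].[s] = e.[s] + u * o.[s].
  move=> us; rewrite -[in LHS](poly_even_odd p) !hornerE !horner_comp !hornerE.
  have hE (q : {poly {poly F}}) : q.[u%:P ^+ 2].[s] = q.[f].[s].
    have ev x : q.[x].[s] = (map_poly (horner_eval s) q).[x.[s]].
      exact: esym (horner_map (horner_eval s) q x).
    by rewrite !ev horner_exp hornerC us.
  by rewrite !hE mulrC.
(* The equation [u * o.[s] = 0] is multiplied by [u], because [f * o] is a polynomial in [s] while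
   [u] depends on a choice of root. *)
have eo s : h.[s] != 0 -> e.[s] = 0 /\ f.[s] * o.[s] = 0.
  move=> hs; have us := sqrtCK f.[s]; set u := sqrtC _ in us.
  have := p0 s u us hs; have := p0 s (- u); rewrite sqrrN => /(_ us hs).
  rewrite !pE ?sqrrN // => m0 q0.
  have e0 : e.[s] = 0.
    have : e.[s] *+ 2 = (e.[s] + u * o.[s]) + (e.[s] + - u * o.[s]) by ring.
    by rewrite q0 m0 addr0 => /eqP; rewrite mulrn_eq0 => /eqP.
  by split=> //; move: q0; rewrite e0 add0r -us expr2 -mulrA => ->; rewrite mulr0.
(* Multiplication by [h] turns vanishing away from the zeros of [h] into vanishing everywhere; the
   nonzero polynomial [h] is then cancelled. *)
have /eqP : h * e = 0.
  apply: poly_eq0_horner => s; rewrite hornerM.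
  by have [->|/eo[-> _]] := eqVneq h.[s] 0; rewrite ?mul0r ?mulr0.
rewrite mulf_eq0 (negPf h0) => /eqP e0.
have /eqP : h * (f * o) = 0.
  apply: poly_eq0_horner => s; rewrite !hornerM.
  by have [->|/eo[_ ->]] := eqVneq h.[s] 0; rewrite ?mul0r ?mulr0.
rewrite !mulf_eq0 (negPf h0) (negPf f0) => /eqP o0 s u /pE->.
by rewrite e0 o0 !horner0 mulr0 addr0.
Qed.

(** Reduction to one variable: everything is restricted to the line joining [v] to a point [c] where
    neither [f] nor [h] vanishes. As [f] and [h] do not involve the coordinate [k], this coordinate
    stays free to be the square root. *)
Lemma vanish_double_cover {n} (k : 'I_n) (f h p : {mpoly F[n]}) (a b : 'I_n -> F) :
  (forall v w, (forall i, i != k -> v i = w i) -> f.@[v] = f.@[w]) ->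
  (forall v w, (forall i, i != k -> v i = w i) -> h.@[v] = h.@[w]) ->
  f.@[a] != 0 -> h.@[b] != 0 ->
  (forall v, v k ^+ 2 = f.@[v] -> h.@[v] != 0 -> p.@[v] = 0) ->
  forall v, v k ^+ 2 = f.@[v] -> p.@[v] = 0.
Proof.
move=> f_k h_k fa hb p0 v vf; have [c [fc hc]] := common_nonzero fa hb.
pose w := line v c.
have w0 := line0 v c : (fun i => (w i).[0]) =1 v.
have w1 := line1 v c : (fun i => (w i).[1]) =1 c.
pose vu s u i := if i == k then u else (w i).[s].
(* The outer variable is the coordinate [k], the inner one the parameter of the line. *)
pose pl := mmap (polyC \o polyC) (fun i => if i == k then 'X else (w i)%:P) p.
have plE u s : pl.[u%:P].[s] = p.@[vu s u].
  rewrite -horner_evalE -horner_evalE !rmorph_mmap; apply: eq_bigr => m _ /=.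
  rewrite !horner_evalE !hornerE; congr (_ * _); apply: eq_bigr => i _ /=.
  by rewrite /vu !horner_evalE; case: eqP => _; rewrite !hornerE.
have wE q s u : (forall v w, (forall i, i != k -> v i = w i) -> q.@[v] = q.@[w]) ->
    (mmap polyC w q).[s] = q.@[vu s u].
  by move=> q_k; rewrite horner_mmap; apply: q_k => i /negPf ik; rewrite /vu ik.
have neq0 q : q.@[c] != 0 -> mmap polyC w q != 0.
  by apply: contraNneq => q0; rewrite -(meval_eq q w1) -horner_mmap q0 horner0.
have vu0 : vu 0 (v k) =1 v.
  by move=> i; rewrite /vu; case: eqP => [->//|_]; apply: w0.
rewrite -(meval_eq p vu0) -plE.
apply: (vanish_double_cover1 (neq0 f fc) (neq0 h hc)) => [s u us hs|].
  rewrite plE; apply: p0; last by rewrite -wE.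
  by rewrite -(wE f s u f_k) -us /vu eqxx.
by rewrite (wE _ _ (v k) f_k) (meval_eq f vu0).
Qed.

End Density.

(** * Polynomial identities for the two maps *)

Section Identities.

Variable K : comNzRingType.
Implicit Type v : 5.-tuple K.

(* L, Q, Q' are the factors of the formula for u', and D, E, S, B those of the
   formula for u''. *)
Definition linL (A0 A1 : K) v :=
  (A0 - A1) * (v`_0 - v`_2) + A1 * (v`_1 + v`_3).
Definition quadQ (A0 A1 : K) v :=
  (A0 - A1) * v`_2 * (v`_0 - v`_1) + A1 * v`_1 * (v`_1 + v`_3).
Definition quadQ' (A0 A1 : K) v :=
  A0 * v`_2 * (v`_0 - v`_1) + A1 * v`_1 * (v`_1 + v`_2 + v`_3 - v`_0).

Definition linD (A0 A1 : K) v := (A0 - A1) * v`_0 + A1 * v`_2.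
Definition linE (A0 A1 : K) v := (A0 - A1) * v`_0 - A1 * v`_1.
Definition quadS (A0 A1 : K) v :=
  (A0 - A1) * v`_0 * (v`_0 + v`_2 + v`_3) - A1 * v`_1 * (v`_0 + v`_2).
Definition quadB (A0 A1 : K) v :=
  A0 ^+ 2 * v`_0 * v`_1
  - A0 * A1 * ((v`_0 + v`_1) * (v`_0 + v`_1 + v`_3) + v`_0 * (v`_1 + v`_2))
  + A1 ^+ 2 * ((v`_0 + v`_1) * (v`_0 + 2 * v`_1 + v`_2 + v`_3)).

(* The factors by which the composite maps rescale (x, y, z, t). *)
Definition scaleX (A0 A1 : K) v :=
  - (A0 - A1) ^+ 2 * (v`_0 - v`_1) ^+ 2 * (v`_1 - v`_2)
  * linL A0 A1 v * quadQ A0 A1 v * quadQ' A0 A1 v.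
Definition scaleY (A0 A1 : K) v :=
  - A1 * v`_1 * linD A0 A1 v ^+ 2 * linE A0 A1 v * quadS A0 A1 v
  * quadB A0 A1 v.

Lemma mapXYE A0 A1 r v :
  mapXY A0 A1 r v =
  [tuple - (A0 - A1) * (v`_0 - v`_1) * (v`_1 - v`_2) * v`_0;
     - (v`_0 - v`_1) * quadQ A0 A1 v;
     (v`_0 - v`_1) * (v`_1 - v`_2)
     * (A0 * v`_0 + A1 * v`_1 + (- A0 + A1) * v`_2 + A1 * v`_3);
     (v`_0 + v`_3) * quadQ' A0 A1 v;
     (A0 - A1) * r * (v`_0 - v`_1) ^+ 2 * (v`_1 - v`_2)
     * linL A0 A1 v * quadQ A0 A1 v * quadQ' A0 A1 v * v`_4].
Proof.
apply: val_inj => /=; rewrite /linL /quadQ /quadQ'.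
do ![congr (_ :: _); first by ring].
Qed.

(** The fourth coordinate is written so that its sum with the first one, the form [x + t] of the
    octic of X, is visibly a product. *)
Lemma mapYXE A0 A1 s v :
  mapYX A0 A1 s v =
  [tuple v`_0 * quadB A0 A1 v;
     - (v`_0 + v`_1) * A1 * quadS A0 A1 v;
     - (A0 * v`_0 + A1 * v`_1 + A1 * v`_2) * quadS A0 A1 v;
     A1 * v`_1 * v`_3 * linD A0 A1 v - v`_0 * quadB A0 A1 v;
     A1 * s * v`_1 * linD A0 A1 v ^+ 2 * linE A0 A1 v * quadS A0 A1 v
     * quadB A0 A1 v * v`_4].
Proof.
apply: val_inj => /=; rewrite /linD /linE /quadS /quadB.
do ![congr (_ :: _); first by ring].
Qed.

(** This and the next three pullbacks keep the composite [mapYX] after [mapXY] in factored form. The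
    parameter of the target is [A0 - A1], whose difference from [A0] is [A1] again. *)
Lemma linD_mapXY A0 A1 r v :
  linD A0 (A0 - A1) (mapXY A0 A1 r v) =
  (A0 - A1) * (v`_0 - v`_1) * (v`_1 - v`_2) * linL A0 A1 v.
Proof. by rewrite mapXYE /linD /linL /=; ring. Qed.

Lemma linE_mapXY A0 A1 r v :
  linE A0 (A0 - A1) (mapXY A0 A1 r v) =
  (A0 - A1) * (v`_0 - v`_1) * quadQ' A0 A1 v.
Proof. by rewrite mapXYE /linE /quadQ' /quadQ /=; ring. Qed.

Lemma quadS_mapXY A0 A1 r v :
  quadS A0 (A0 - A1) (mapXY A0 A1 r v) =
  - (A0 - A1) * (v`_0 - v`_1) * (v`_1 - v`_2) * quadQ A0 A1 v * quadQ' A0 A1 v.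
Proof. by rewrite mapXYE /quadS /quadQ' /quadQ /=; ring. Qed.

Lemma quadB_mapXY A0 A1 r v :
  quadB A0 (A0 - A1) (mapXY A0 A1 r v) =
  (A0 - A1) * (v`_0 - v`_1) * linL A0 A1 v * quadQ A0 A1 v * quadQ' A0 A1 v.
Proof. by rewrite mapXYE /quadB /quadQ' /quadQ /linL /=; ring. Qed.

Lemma linL_mapYX A0 A1 s v :
  linL A0 (A0 - A1) (mapYX A0 A1 s v) = - linD A0 A1 v * quadB A0 A1 v.
Proof. by rewrite mapYXE /linL /linD /quadS /quadB /=; ring. Qed.

Lemma quadQ_mapYX A0 A1 s v :
  quadQ A0 (A0 - A1) (mapYX A0 A1 s v) =
  A1 * v`_1 * linD A0 A1 v * quadS A0 A1 v * quadB A0 A1 v.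
Proof. by rewrite mapYXE /quadQ /linD /quadS /quadB /=; ring. Qed.

Lemma quadQ'_mapYX A0 A1 s v :
  quadQ' A0 (A0 - A1) (mapYX A0 A1 s v) =
  - linD A0 A1 v * linE A0 A1 v * quadS A0 A1 v * quadB A0 A1 v.
Proof. by rewrite mapYXE /quadQ' /linD /linE /quadS /quadB /=; ring. Qed.

Lemma mapYX_subxy A0 A1 s v :
  (mapYX A0 A1 s v)`_0 - (mapYX A0 A1 s v)`_1 =
  v`_1 * linD A0 A1 v * linE A0 A1 v.
Proof. by rewrite mapYXE /linD /linE /quadS /quadB /=; ring. Qed.

Lemma mapYX_subyz A0 A1 s v :
  (mapYX A0 A1 s v)`_1 - (mapYX A0 A1 s v)`_2 = linD A0 A1 v * quadS A0 A1 v.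
Proof. by rewrite mapYXE /linD /quadS /=; ring. Qed.

(** In the last coordinate the factors contribute [A0 - A1] to the seventh power only; the product
    [s * r] of the two roots supplies the eighth, as required by [scaleX A0 A1 v ^+ 4]. *)
Lemma mapXYK A0 A1 r s v : s * r = A0 - A1 ->
  mapYX A0 (A0 - A1) s (mapXY A0 A1 r v) =
  [tuple scaleX A0 A1 v * v`_0; scaleX A0 A1 v * v`_1; scaleX A0 A1 v * v`_2;
     scaleX A0 A1 v * v`_3; scaleX A0 A1 v ^+ 4 * v`_4].
Proof.
move=> sr; rewrite [LHS]mapYXE linD_mapXY linE_mapXY quadS_mapXY quadB_mapXY.
rewrite mapXYE; apply: val_inj => /=; rewrite /scaleX.
congr [:: _; _; _; _; _].
- by ring.
- by rewrite /quadQ /linL; ring.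
- by rewrite /quadQ /linL; ring.
- by ring.
by ring: sr.
Qed.

Lemma mapYXK A0 A1 r s v : s * r = A1 ->
  mapXY A0 (A0 - A1) r (mapYX A0 A1 s v) =
  [tuple scaleY A0 A1 v * v`_0; scaleY A0 A1 v * v`_1; scaleY A0 A1 v * v`_2;
     scaleY A0 A1 v * v`_3; scaleY A0 A1 v ^+ 4 * v`_4].
Proof.
move=> sr; rewrite [LHS]mapXYE linL_mapYX quadQ_mapYX quadQ'_mapYX.
rewrite mapYX_subxy mapYX_subyz.
rewrite mapYXE; apply: val_inj => /=; rewrite /scaleY.
congr [:: _; _; _; _; _].
- by ring.
- by ring.
- by rewrite /linD /quadB /quadS; ring.
- by ring.
by ring: sr.
Qed.

(** Four of the eight forms are coordinates of the map, factored by [mapXYE]; the other four are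
    factored one by one. The cofactor is [A0 - A1] times a square, which is the reason for the
    square root in the last coordinate. *)
Lemma octicY_mapXY A0 A1 r v :
  octicY A0 (A0 - A1) (mapXY A0 A1 r v) =
  (A0 - A1) ^+ 3 * (v`_0 - v`_1) ^+ 4 * (v`_1 - v`_2) ^+ 2
  * (linL A0 A1 v * quadQ A0 A1 v * quadQ' A0 A1 v) ^+ 2 * octicX A0 A1 v.
Proof.
rewrite /octicY; set f := mapXY A0 A1 r v.
have fxy : f`_0 + f`_1 = - (v`_0 - v`_1) * v`_1 * linL A0 A1 v.
  by rewrite /f mapXYE /linL /quadQ /=; ring.
have fN : A0 * f`_0 + (A0 - A1) * f`_1 + (A0 - A1) * f`_2 =
    - (A0 - A1) * (v`_0 - v`_1) * v`_2 * linL A0 A1 v.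
  by rewrite /f mapXYE /linL /quadQ /=; ring.
have fH : (- A0 + (A0 - A1)) * f`_0 + (A0 - A1) * f`_1 + (A0 - A1) * f`_3 =
    (A0 - A1) * (v`_1 + v`_3) * quadQ' A0 A1 v.
  by rewrite /f mapXYE /quadQ /quadQ' /=; ring.
have fxyzt : f`_0 + f`_1 + f`_2 + f`_3 = (v`_2 + v`_3) * quadQ A0 A1 v.
  by rewrite /f mapXYE /quadQ /quadQ' /=; ring.
by rewrite fxyzt fN fH fxy /f mapXYE /octicX /=; ring.
Qed.

Lemma octicX_mapYX A0 A1 s v :
  octicX A0 (A0 - A1) (mapYX A0 A1 s v) =
  A1 ^+ 3 * v`_1 ^+ 2 * linD A0 A1 v ^+ 4
  * (linE A0 A1 v * quadS A0 A1 v * quadB A0 A1 v) ^+ 2 * octicY A0 A1 v.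
Proof.
rewrite /octicX mapYX_subxy; set g := mapYX A0 A1 s v.
have gyt : g`_1 + g`_3 =
    v`_1 * ((- A0 + A1) * v`_0 + A1 * v`_1 + A1 * v`_3) * linD A0 A1 v.
  by rewrite /g mapYXE /linD /quadS /quadB /=; ring.
have gxt : g`_0 + g`_3 = A1 * v`_1 * v`_3 * linD A0 A1 v.
  by rewrite /g mapYXE /=; ring.
have gM : A0 * g`_0 + (A0 - A1) * g`_1 + (- A0 + (A0 - A1)) * g`_2
    + (A0 - A1) * g`_3 = - A1 * v`_2 * quadB A0 A1 v.
  by rewrite /g mapYXE /linD /quadS /quadB /=; ring.
have gzt : g`_2 + g`_3 =
    - (v`_0 + v`_1 + v`_2 + v`_3) * linD A0 A1 v * linE A0 A1 v.
  by rewrite /g mapYXE /linD /linE /quadS /quadB /=; ring.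
by rewrite gyt gxt gM gzt /g mapYXE /octicY /=; ring.
Qed.

(** The cube is explained by computing the triple composite f g f in two ways: f is cubic in
    [(x, y, z, t)], so rescaling its argument by [scaleX] rescales its value by [scaleX ^+ 3]. *)
Lemma scaleY_mapXY (A0 A1 r : K) v :
  scaleY A0 (A0 - A1) (mapXY A0 A1 r v) = scaleX A0 A1 v ^+ 3.
Proof.
rewrite /scaleY linD_mapXY linE_mapXY quadS_mapXY quadB_mapXY mapXYE /scaleX.
by rewrite /=; ring.
Qed.

Lemma scaleX_mapYX (A0 A1 s : K) v :
  scaleX A0 (A0 - A1) (mapYX A0 A1 s v) = scaleY A0 A1 v ^+ 3.
Proof.
rewrite /scaleX linL_mapYX quadQ_mapYX quadQ'_mapYX mapYX_subxy mapYX_subyz.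
by rewrite /scaleY; ring.
Qed.

Lemma scaleX0 (A0 A1 : K) : scaleX A0 A1 [tuple 0; 0; 0; 0; 0] = 0.
Proof. by rewrite /scaleX /=; ring. Qed.

Lemma scaleY0 (A0 A1 : K) : scaleY A0 A1 [tuple 0; 0; 0; 0; 0] = 0.
Proof. by rewrite /scaleY /=; ring. Qed.

End Identities.

(** * Compatibility of the formulas with ring morphisms *)

Section Morphisms.

Variables (K K' : comNzRingType) (g : {rmorphism K -> K'}).
Implicit Type v : 5.-tuple K.

Lemma nth_map_tuple n (v : n.-tuple K) i : (map_tuple g v)`_i = g v`_i.
Proof.
have [iv|iv] := ltnP i (size v); first exact: nth_map.
by rewrite !nth_default ?rmorph0 // size_map.
Qed.

Lemma octicX_rmorph A0 A1 v :
  g (octicX A0 A1 v) = octicX (g A0) (g A1) (map_tuple g v).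
Proof. by rewrite /octicX !nth_map_tuple /= !(rmorphM, rmorphE). Qed.

Lemma octicY_rmorph A0 A1 v :
  g (octicY A0 A1 v) = octicY (g A0) (g A1) (map_tuple g v).
Proof. by rewrite /octicY !nth_map_tuple /= !(rmorphM, rmorphE). Qed.

Lemma scaleX_rmorph A0 A1 v :
  g (scaleX A0 A1 v) = scaleX (g A0) (g A1) (map_tuple g v).
Proof.
by rewrite /scaleX /linL /quadQ /quadQ' !nth_map_tuple !(rmorphM, rmorphE).
Qed.

Lemma scaleY_rmorph A0 A1 v :
  g (scaleY A0 A1 v) = scaleY (g A0) (g A1) (map_tuple g v).
Proof.
by rewrite /scaleY /linD /linE /quadS /quadB !nth_map_tuple !(rmorphM, rmorphE).
Qed.

Lemma mapXY_rmorph A0 A1 r v i :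
  g (tnth (mapXY A0 A1 r v) i) =
  tnth (mapXY (g A0) (g A1) (g r) (map_tuple g v)) i.
Proof.
rewrite !(tnth_nth 0).
by case: i => -[|[|[|[|[|//]]]]] ? /=; rewrite !nth_map_tuple !(rmorphM, rmorphE).
Qed.

Lemma mapYX_rmorph A0 A1 s v i :
  g (tnth (mapYX A0 A1 s v) i) =
  tnth (mapYX (g A0) (g A1) (g s) (map_tuple g v)) i.
Proof.
rewrite !(tnth_nth 0).
by case: i => -[|[|[|[|[|//]]]]] ? /=; rewrite !nth_map_tuple !(rmorphM, rmorphE).
Qed.

End Morphisms.

(** * Single members of the two families *)

Section Fibers.

Variable F : numClosedFieldType.
Implicit Types v w : 5.-tuple F.

Lemma octicX_normalized (A0 A1 : F) v :
  A0 != 0 -> octicX 1 (A1 / A0) v = octicX A0 A1 v / A0.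
Proof. by move=> A00; rewrite /octicX /=; field. Qed.

Lemma octicY_normalized (A0 A1 : F) v :
  A0 != 0 -> octicY 1 (A1 / A0) v = octicY A0 A1 v / A0 ^+ 2.
Proof. by move=> A00; rewrite /octicY /=; field. Qed.

Lemma same_point_fiber (c : F) v : c != 0 ->
  same_point weights_fiber v
    [tuple c * v`_0; c * v`_1; c * v`_2; c * v`_3; c ^+ 4 * v`_4].
Proof.
move=> c0; exists (fun=> c); split=> // i; rewrite big_ord1 !(tnth_nth 0).
by case: i => -[|[|[|[|[|//]]]]] ?.
Qed.

Lemma fiberX_mapXY (A0 A1 r : F) v :
  A0 != 0 -> r ^+ 2 = (A0 - A1) / A0 ->
  fiberX A0 A1 v -> scaleX A0 A1 v != 0 -> fiberY A0 (A0 - A1) (mapXY A0 A1 r v).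
Proof.
move=> A00 r2 [_ v4] cv; split.
  (* The image is not the origin, because [scaleY] vanishes at the origin but takes the value
     [scaleX A0 A1 v ^+ 3] at the image. *)
  by apply: contraNneq (expf_neq0 3 cv) => f0; rewrite -(scaleY_mapXY _ _ r) f0 scaleY0.
rewrite octicY_normalized // octicY_mapXY mapXYE /= !exprMn r2 v4.
by rewrite octicX_normalized //; field.
Qed.

Lemma fiberY_mapYX (A0 A1 s : F) v :
  A0 != 0 -> s ^+ 2 = A0 * A1 ->
  fiberY A0 A1 v -> scaleY A0 A1 v != 0 -> fiberX A0 (A0 - A1) (mapYX A0 A1 s v).
Proof.
move=> A00 s2 [_ v4] cv; split.
  by apply: contraNneq (expf_neq0 3 cv) => f0; rewrite -(scaleX_mapYX _ _ s) f0 scaleX0.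
rewrite octicX_normalized // octicX_mapYX mapYXE /= !exprMn s2 v4.
by rewrite octicY_normalized //; field.
Qed.

Lemma double_cover_fiber_vanish (f h p : {mpoly F[5]}) a b :
  (forall v w, (forall i, (i < 4)%N -> v`_i = w`_i) -> f.@[tnth v] = f.@[tnth w]) ->
  (forall v w, (forall i, (i < 4)%N -> v`_i = w`_i) -> h.@[tnth v] = h.@[tnth w]) ->
  f.@[tnth a] != 0 -> h.@[tnth b] != 0 ->
  (forall v, v`_4 ^+ 2 = f.@[tnth v] -> h.@[tnth v] != 0 -> p.@[tnth v] = 0) ->
  forall v, v`_4 ^+ 2 = f.@[tnth v] -> p.@[tnth v] = 0.
Proof.
move=> f4 h4 fa hb p0 v; pose k : 'I_5 := @Ordinal 5 4 isT.
have tupleE (w : 'I_5 -> F) : tnth (mktuple w) =1 w by move=> i; rewrite tnth_mktuple.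
have first4 (q : {mpoly F[5]}) :
    (forall v w, (forall i, (i < 4)%N -> v`_i = w`_i) -> q.@[tnth v] = q.@[tnth w]) ->
    forall w w' : 'I_5 -> F, (forall i, i != k -> w i = w' i) -> q.@[w] = q.@[w'].
  move=> q4 w w' ww'; rewrite -(meval_eq q (tupleE w)) -(meval_eq q (tupleE w')).
  apply: q4 => i i4; have i5 : (i < 5)%N by rewrite ltnS ltnW.
  rewrite -!(tnth_nth 0 _ (Ordinal i5)) !tupleE; apply: ww'.
  by rewrite -val_eqE neq_ltn i4.
have kE (w : 5.-tuple F) : w`_4 = tnth w k by rewrite (tnth_nth 0).
rewrite kE; apply: (vanish_double_cover (first4 f f4) (first4 h h4) fa hb).
move=> w wf wh; rewrite -(meval_eq p (tupleE w)); apply: p0.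
  by rewrite kE tupleE wf; apply: meval_eq => i; rewrite tupleE.
by rewrite (meval_eq h (tupleE w)).
Qed.

(** A formula applied to this point is a polynomial, and evaluating it at [v] gives the formula
    applied to [v]. *)
Definition generic_point n : n.-tuple {mpoly F[n]} := [tuple 'X_i | i < n].

Lemma meval_generic_point n (v : n.-tuple F) :
  map_tuple (meval (tnth v)) (generic_point n) = v.
Proof. by apply: eq_from_tnth => i; rewrite tnth_map tnth_mktuple mevalXU. Qed.

Lemma fiberX_vanish (A0 A1 : F) (p : {mpoly F[5]}) :
  A0 != 0 -> A1 != A0 ->
  (forall v, fiberX A0 A1 v -> scaleX A0 A1 v != 0 -> p.@[tnth v] = 0) ->
  forall v, fiberX A0 A1 v -> p.@[tnth v] = 0.
Proof.
move=> A00 A10 p0 v [_ v4].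
pose f := octicX 1 (A1 / A0)%:MP (generic_point 5).
pose h := scaleX A0%:MP A1%:MP (generic_point 5).
have fE w : f.@[tnth w] = octicX 1 (A1 / A0) w.
  by rewrite octicX_rmorph rmorph1 /= mevalC meval_generic_point.
have hE w : h.@[tnth w] = scaleX A0 A1 w.
  by rewrite scaleX_rmorph /= !mevalC meval_generic_point.
(* At the first point [A1] cancels from the only form containing parameters. At the second,
   [y = t = 0] makes [linL] and [quadQ] multiples of [A0 - A1] and [quadQ'] a multiple of [A0]. *)
apply: (@double_cover_fiber_vanish f h p [tuple 2; 3; 1; - 4; 0] [tuple 2; 0; 1; 0; 0]).
- by move=> w w' ww'; rewrite !fE /octicX !ww'.
- by move=> w w' ww'; rewrite !hE /scaleX /linL /quadQ /quadQ' !ww'.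
- rewrite fE octicX_normalized //.
  have -> : octicX A0 A1 [tuple 2; 3; 1; - 4; 0] = 36%:R * A0.
    by rewrite /octicX /=; ring.
  by rewrite mulfK // pnatr_eq0.
- rewrite hE; have -> : scaleX A0 A1 [tuple 2; 0; 1; 0; 0] =
      16%:R * (A0 - A1) ^+ 4 * A0.
    by rewrite /scaleX /linL /quadQ /quadQ' /=; ring.
  have A01 : A0 - A1 != 0 by rewrite subr_eq0 eq_sym.
  by rewrite !mulf_neq0 ?pnatr_eq0 //; apply: expf_neq0.
(* The double cover used here is affine and may contain the origin, which the condition on [scaleX]
   excludes. *)
- move=> w w4; rewrite hE => hw; apply: p0 => //; split; last by rewrite w4 fE.
  by apply: contraNneq hw => ->; rewrite scaleX0.
by rewrite fE.
Qed.

Lemma fiberY_vanish (A0 A1 : F) (p : {mpoly F[5]}) :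
  A0 != 0 -> A1 != 0 ->
  (forall v, fiberY A0 A1 v -> scaleY A0 A1 v != 0 -> p.@[tnth v] = 0) ->
  forall v, fiberY A0 A1 v -> p.@[tnth v] = 0.
Proof.
move=> A00 A10 p0 v [_ v4].
pose f := octicY 1 (A1 / A0)%:MP (generic_point 5).
pose h := scaleY A0%:MP A1%:MP (generic_point 5).
have fE w : f.@[tnth w] = octicY 1 (A1 / A0) w.
  by rewrite octicY_rmorph rmorph1 /= mevalC meval_generic_point.
have hE w : h.@[tnth w] = scaleY A0 A1 w.
  by rewrite scaleY_rmorph /= !mevalC meval_generic_point.
(* At the first point the two forms containing parameters become [A0] and [- A0]. At the second,
   [x = 0] and [y + t = 0] leave only powers of [A1]. *)
apply: (@double_cover_fiber_vanish f h p [tuple 1; 1; -1; - 2; 0] [tuple 0; 1; 1; - 1; 0]).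
- by move=> w w' ww'; rewrite !fE /octicY !ww'.
- by move=> w w' ww'; rewrite !hE /scaleY /linD /linE /quadS /quadB !ww'.
- rewrite fE octicY_normalized //.
  have -> : octicY A0 A1 [tuple 1; 1; - 1; - 2; 0] = 4%:R * A0 ^+ 2.
    by rewrite /octicY /=; ring.
  by rewrite mulfK ?expf_neq0 // pnatr_eq0.
- rewrite hE; have -> : scaleY A0 A1 [tuple 0; 1; 1; - 1; 0] = - 2%:R * A1 ^+ 7.
    by rewrite /scaleY /linD /linE /quadS /quadB /=; ring.
  by rewrite mulf_eq0 oppr_eq0 expf_eq0 pnatr_eq0 A10.
- move=> w w4; rewrite hE => hw; apply: p0 => //; split; last by rewrite w4 fE.
  by apply: contraNneq hw => ->; rewrite scaleY0.
by rewrite fE.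
Qed.

End Fibers.

(** * Degrees of the maps and of the scaling factors *)

Section Degrees.

Variables (F : fieldType) (n : nat) (w : 'I_n -> nat) (a e : nat).
Variables (A0 A1 r : {mpoly F[n]}) (v : 5.-tuple {mpoly F[n]}).
Hypotheses (hA0 : whomog w a A0) (hA1 : whomog w a A1).
Hypothesis hv : forall i, whomog w (weights_fiber ord0 i * e) (tnth v i).

Let hv_nth i (i5 : (i < 5)%N) :
  whomog w (weights_fiber ord0 (Ordinal i5) * e) v`_i.
Proof. by rewrite -(tnth_nth 0 _ (Ordinal i5)). Qed.

Let hx : whomog w e v`_0.
Proof. by have := hv_nth (i := 0) isT; rewrite /weights_fiber /= mul1n. Qed.
Let hy : whomog w e v`_1.
Proof. by have := hv_nth (i := 1) isT; rewrite /weights_fiber /= mul1n. Qed.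
Let hz : whomog w e v`_2.
Proof. by have := hv_nth (i := 2) isT; rewrite /weights_fiber /= mul1n. Qed.
Let ht : whomog w e v`_3.
Proof. by have := hv_nth (i := 3) isT; rewrite /weights_fiber /= mul1n. Qed.
Let hu : whomog w (4 * e) v`_4.
Proof. exact: (hv_nth (i := 4) isT). Qed.

(** Here [a] is the degree of the parameters and [e] that of [x, y, z, t]. A single fibre has
    [a = 0] and [e = 1]; on the total space each of the two torus factors has one of them equal to 1
    and the other to 0. *)
Lemma whomog_mapXY i : whomog w 0 r ->
  whomog w (weights_fiber ord0 i * (3 * e + a)) (tnth (mapXY A0 A1 r v) i).
Proof.
move=> hr; rewrite (tnth_nth 0).
by case: i => -[|[|[|[|[|//]]]]] ? /=; rewrite /weights_fiber /=; whomog_tac.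
Qed.

Lemma whomog_mapYX i : whomog w a r ->
  whomog w (weights_fiber ord0 i * (3 * e + 2 * a)) (tnth (mapYX A0 A1 r v) i).
Proof.
move=> hr; rewrite (tnth_nth 0).
by case: i => -[|[|[|[|[|//]]]]] ? /=; rewrite /weights_fiber /=; whomog_tac.
Qed.

Lemma whomog_scaleX : whomog w (8 * e + 5 * a) (scaleX A0 A1 v).
Proof. by rewrite /scaleX /linL /quadQ /quadQ'; whomog_tac. Qed.

Lemma whomog_scaleY : whomog w (8 * e + 7 * a) (scaleY A0 A1 v).
Proof. by rewrite /scaleY /linD /linE /quadS /quadB; whomog_tac. Qed.

End Degrees.

Lemma whomog_multihomog {F : fieldType} k n (W : weights k n) d (p : {mpoly F[n]}) :
  (forall j, whomog (W j) (d j) p) -> multihomog W p.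
Proof. by move=> hp; exists d => m mp j; apply: hp. Qed.

(** * The birational maps between fibres *)

Section FiberMaps.

Variable F : numClosedFieldType.

(** The branch [r] determines the other root: [A0 * r] is a square root of [A0 * (A0 - A1)], and its
    product with [r] is [A0 - A1]. *)
Lemma fiber_birational_inverse (A0 A1 r : F) :
  A0 != 0 -> A1 != A0 -> r ^+ 2 = (A0 - A1) / A0 ->
  birational_inverse weights_fiber weights_fiber
    (fiberX A0 A1) (fiberY A0 (A0 - A1))
    (mapXY A0 A1 r) (mapYX A0 (A0 - A1) (A0 * r)).
Proof.
move=> A00 A10 r2; set al := A0 - A1.
have al0 : al != 0 by rewrite subr_eq0 eq_sym.
have alK : A0 - al = A1 by rewrite /al opprB addrC subrK.
pose cst (c : F) : {mpoly F[5]} := c%:MP; pose x := generic_point F 5.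
have hx j i : whomog (weights_fiber j) (weights_fiber ord0 i * 1) (tnth x i).
  by rewrite tnth_mktuple muln1; apply: whomogXi.
have hc j c : whomog (weights_fiber j) 0 (cst c) by apply: whomogC.
pose c := scaleX (cst A0) (cst A1) x; pose d := scaleY (cst A0) (cst al) x.
have cE v : c.@[tnth v] = scaleX A0 A1 v.
  by rewrite scaleX_rmorph /= !mevalC meval_generic_point.
have dE v : d.@[tnth v] = scaleY A0 al v.
  by rewrite scaleY_rmorph /= !mevalC meval_generic_point.
apply: (birational_inverse_poly
  (P := tnth (mapXY (cst A0) (cst A1) (cst r) x))
  (Q := tnth (mapYX (cst A0) (cst al) (cst (A0 * r)) x))
  (D := fun _ _ => 3%N) (D' := fun _ _ => 3%N)
  (c := c) (d := d)).
- by move=> v i; rewrite mapXY_rmorph /= !mevalC meval_generic_point.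
- by move=> v i; rewrite mapYX_rmorph /= !mevalC meval_generic_point.
- by move=> i j; rewrite big_ord1; apply: (whomog_mapXY (a := 0) (e := 1)).
- by move=> i j; rewrite big_ord1; apply: (whomog_mapYX (a := 0) (e := 1)).
- by apply: (whomog_multihomog (d := fun=> 8%N)) => j;
    apply: (whomog_scaleX (a := 0) (e := 1)).
- by apply: (whomog_multihomog (d := fun=> 8%N)) => j;
    apply: (whomog_scaleY (a := 0) (e := 1)).
(* Density is checked separately for each equation [p] of the closed set. *)
- move=> Z [S [_ ZS]] UZ v Xv; apply/ZS => p Sp.
  apply: (fiberX_vanish A00 A10 _ Xv) => {Xv}v Xv cv.
  by apply: (ZS v).1 => //; apply: UZ; rewrite cE.
- move=> Z [S [_ ZS]] UZ v Yv; apply/ZS => p Sp.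
  apply: (fiberY_vanish A00 al0 _ Yv) => {Yv}v Yv cv.
  by apply: (ZS v).1 => //; apply: UZ; rewrite dE.
- move=> v Xv; rewrite cE dE => cv; split.
  + exact: fiberX_mapXY.
  + by rewrite scaleY_mapXY expf_neq0.
  rewrite mapXYK; first exact: same_point_fiber.
  by rewrite -mulrA -expr2 r2 mulrC divfK.
move=> v Yv; rewrite cE dE => cv; have s2 : (A0 * r) ^+ 2 = A0 * al.
  by rewrite exprMn r2 expr2 -mulrA mulrCA divff // mulr1.
split.
+ by have := fiberY_mapYX A00 s2 Yv cv; rewrite alK.
+ by have := scaleX_mapYX A0 al (A0 * r) v; rewrite alK => ->; rewrite expf_neq0.
have rr : A0 * r * r = al by rewrite -mulrA -expr2 r2 mulrC divfK.
by have := mapYXK A0 v rr; rewrite alK => ->; apply: same_point_fiber.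
Qed.

End FiberMaps.

(** * The birational maps between total spaces *)

Section TotalMaps.

Variable F : numClosedFieldType.

(* [fiber_coords], [total_mapXY] and [total_mapYX] are defined over fields only;
   [fiber_part] and [total_coord] express them over polynomial rings as well. *)
Definition fiber_part (K : comNzRingType) (p : 8.-tuple K) : 5.-tuple K :=
  [tuple p`_0; p`_1; p`_2; p`_3; p`_4].

Definition total_coord (K : comNzRingType) (v : 5.-tuple K) (A0 A1 r : K)
    (i : 'I_8) : K :=
  match split (i : 'I_(5 + 3)) with
  | inl j => tnth v j
  | inr j => tnth [tuple A0; A1; r] j
  end.

Lemma tnth_total_point (v : 5.-tuple F) A0 A1 r i :
  tnth (total_point v A0 A1 r) i = total_coord v A0 A1 r i.
Proof.
rewrite /total_coord (tnth_nth 0); case: splitP => j ->; rewrite (tnth_nth 0).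
  by case: j => -[|[|[|[|[|//]]]]].
by case: j => -[|[|[|//]]].
Qed.

Lemma fiber_part_rmorph (K K' : comNzRingType) (g : {rmorphism K -> K'}) p :
  map_tuple g (fiber_part p) = fiber_part (map_tuple g p).
Proof. by apply: val_inj; rewrite /= -!nth_map_tuple. Qed.

Lemma fiber_coordsK (v : 5.-tuple F) A0 A1 r :
  fiber_coords (total_point v A0 A1 r) = v.
Proof.
apply: eq_from_tnth => i; rewrite !(tnth_nth 0).
by case: i => -[|[|[|[|[|//]]]]].
Qed.

Lemma total_pointK (p : 8.-tuple F) :
  total_point (fiber_coords p) p`_5 p`_6 p`_7 = p.
Proof.
apply: eq_from_tnth => i; rewrite !(tnth_nth 0).
by case: i => -[|[|[|[|[|[|[|[|//]]]]]]]].
Qed.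

Lemma totalX_point (v : 5.-tuple F) A0 A1 r :
  totalX (total_point v A0 A1 r) <->
  [/\ A0 != 0, A1 != A0, r ^+ 2 = (A0 - A1) / A0 & fiberX A0 A1 v].
Proof. by rewrite /totalX fiber_coordsK. Qed.

Lemma totalY_point (v : 5.-tuple F) A0 A1 r :
  totalY (total_point v A0 A1 r) <->
  [/\ A0 != 0, A1 != 0, r ^+ 2 = A1 / A0 & fiberY A0 A1 v].
Proof. by rewrite /totalY fiber_coordsK. Qed.

(** The torus factor of the fibre coordinates acts by [c], that of the parameter line by 1. *)
Lemma same_point_total (c : F) v A0 A1 r : c != 0 ->
  same_point weights_total (total_point v A0 A1 r)
    (total_point [tuple c * v`_0; c * v`_1; c * v`_2; c * v`_3; c ^+ 4 * v`_4]
       A0 A1 r).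
Proof.
move=> c0; exists (fun j : 'I_2 => if j == ord0 then c else 1).
split=> [j|i]; first by case: ifP; rewrite ?oner_neq0.
rewrite big_ord_recl big_ord1 /= expr1n mulr1 !(tnth_nth 0).
by case: i => -[|[|[|[|[|[|[|[|//]]]]]]]] ? /=; rewrite /weights_total /= ?mul1r.
Qed.

(** Substituting constants for the last three coordinates reduces density in the total space to
    density in the fibres. *)
Lemma restrict_to_fiber (q : {mpoly F[8]}) A0 A1 r :
  exists q5 : {mpoly F[5]},
    forall v : 5.-tuple F, q5.@[tnth v] = q.@[tnth (total_point v A0 A1 r)].
Proof.
exists (q \mPo [tuple total_coord (generic_point F 5) A0%:MP A1%:MP r%:MP i | i < 8]).
move=> v; rewrite comp_mpoly_meval; apply: meval_eq => i.
rewrite tnth_mktuple tnth_total_point /total_coord; case: split => j.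
  by rewrite tnth_mktuple mevalXU.
by case: j => -[|[|[|//]]] ?; rewrite !(tnth_nth 0) /= mevalC.
Qed.

Lemma nth_generic_point n i (ltin : (i < n)%N) :
  (generic_point F n)`_i = 'X_(Ordinal ltin).
Proof. by rewrite -(tnth_nth 0 _ (Ordinal ltin)) tnth_mktuple. Qed.

Let x := generic_point F 8.

Lemma whomog_generic_fiber j i :
  whomog (weights_total j) (weights_fiber ord0 i * (j == ord0))
    (tnth (fiber_part x) i).
Proof.
rewrite (tnth_nth 0).
by case: i => -[|[|[|[|[|//]]]]] ?; rewrite /= nth_generic_point //;
  apply: (whomog_eq (whomogXi _)); case: j => -[|[|//]].
Qed.

Lemma whomog_generic_param j i : (5 <= i < 7)%N ->
  whomog (weights_total j) (j != ord0) x`_i.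
Proof.
case: i => [|[|[|[|[|[|[|//]]]]]]] // _; rewrite nth_generic_point //;
  by apply: (whomog_eq (whomogXi _)); case: j => -[|[|//]].
Qed.

Lemma whomog_generic_root j : whomog (weights_total j) 0 x`_7.
Proof.
rewrite nth_generic_point //.
by apply: (whomog_eq (whomogXi _)); case: j => -[|[|//]].
Qed.

(** Row [ord0] of [D] belongs to the fibre coordinates of the target, row [ord_max] to its
    parameters; the root has degree 0. *)
Lemma whomog_total_coord (D : 'I_2 -> 'I_2 -> nat) v A0 A1 r i j :
  (forall i, whomog (weights_total j) (weights_fiber ord0 i * D ord0 j) (tnth v i)) ->
  whomog (weights_total j) (D ord_max j) A0 ->
  whomog (weights_total j) (D ord_max j) A1 ->
  whomog (weights_total j) 0 r ->
  whomog (weights_total j) (\sum_l weights_total l i * D l j)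
    (total_coord v A0 A1 r i : {mpoly F[8]}).
Proof.
move=> hv hA0 hA1 hr; rewrite big_ord_recl big_ord1.
have -> : lift ord0 ord0 = ord_max :> 'I_2 by apply: val_inj.
rewrite /total_coord; case: splitP => k ik.
  apply: (whomog_eq (hv k)); rewrite /weights_total /weights_fiber ik.
  by case: k {ik} => -[|[|[|[|[|//]]]]] ? /=; rewrite addn0.
rewrite /weights_total ik (tnth_nth 0); case: k {ik} => -[|[|[|//]]] ? /=.
- by rewrite add0n mul1n.
- by rewrite add0n mul1n.
exact: hr.
Qed.

Lemma total_birational_inverse :
  birational_inverse weights_total weights_total
    (@totalX F) (@totalY F) (@total_mapXY F) (@total_mapYX F).
Proof.
(* Both maps are cubic in the fibre coordinates; [m] is their degree in the parameters, 1 for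
   [mapXY] and 2 for [mapYX]. The new parameters are linear in the old ones. *)
pose D (m : nat) (l j : 'I_2) :=
  (if l == ord0 then 3 * (j == ord0) + m * (j != ord0) else (j != ord0))%N.
pose c := scaleX x`_5 x`_6 (fiber_part x).
pose d := scaleY x`_5 x`_6 (fiber_part x).
have xE i p : (x`_i).@[tnth p] = p`_i.
  by rewrite -(nth_map_tuple (meval (tnth p))) meval_generic_point.
have xfE p : map_tuple (meval (tnth p)) (fiber_part x) = fiber_coords p.
  by rewrite fiber_part_rmorph meval_generic_point.
have cE p : c.@[tnth p] = scaleX p`_5 p`_6 (fiber_coords p).
  by rewrite scaleX_rmorph /= !xE xfE.
have dE p : d.@[tnth p] = scaleY p`_5 p`_6 (fiber_coords p).
  by rewrite scaleY_rmorph /= !xE xfE.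
have hA0 j := whomog_generic_param j (i := 5) isT.
have hA1 j := whomog_generic_param j (i := 6) isT.
have hr := whomog_generic_root.
have hA j := whomogD (hA0 j) (whomogN (hA1 j)).
apply: (birational_inverse_poly
  (P := total_coord (mapXY x`_5 x`_6 x`_7 (fiber_part x)) x`_5 (x`_5 - x`_6) x`_7)
  (Q := total_coord (mapYX x`_5 x`_6 (x`_5 * x`_7) (fiber_part x))
          x`_5 (x`_5 - x`_6) x`_7)
  (D := D 1%N) (D' := D 2%N) (c := c) (d := d)).
- move=> p i; rewrite tnth_total_point /total_coord; case: split => k.
    by rewrite mapXY_rmorph /= !xE xfE.
  by case: k => -[|[|[|//]]] ?; rewrite !(tnth_nth 0) /= ?mevalB !xE.
- move=> p i; rewrite tnth_total_point /total_coord; case: split => k.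
    by rewrite mapYX_rmorph /= mevalM !xE xfE.
  by case: k => -[|[|[|//]]] ?; rewrite !(tnth_nth 0) /= ?mevalB !xE.
- move=> i j; apply: whomog_total_coord => //= k; rewrite /D /= mul1n.
  exact: (whomog_mapXY (hA0 j) (hA1 j) (whomog_generic_fiber j)).
- move=> i j; apply: whomog_total_coord => //= k; rewrite /D /=.
  apply: (whomog_mapYX (hA0 j) (hA1 j) (whomog_generic_fiber j)).
  by apply: (whomog_eq (whomogM (hA0 j) (hr j))); rewrite addn0.
- apply: whomog_multihomog => j.
  exact: (whomog_scaleX (hA0 j) (hA1 j) (whomog_generic_fiber j)).
- apply: whomog_multihomog => j.
  exact: (whomog_scaleY (hA0 j) (hA1 j) (whomog_generic_fiber j)).
- move=> Z [S [_ ZS]] UZ p; rewrite -[p]total_pointK totalX_point => -[A00 A10 r2 Xv].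
  apply/ZS => q Sq; have [q5 q5E] := restrict_to_fiber q p`_5 p`_6 p`_7.
  rewrite -q5E; apply: (fiberX_vanish A00 A10 _ Xv) => v Xv' cv; rewrite q5E.
  apply: (ZS _).1 => //; apply: UZ; rewrite totalX_point cE fiber_coordsK.
  by split.
- move=> Z [S [_ ZS]] UZ p; rewrite -[p]total_pointK totalY_point => -[A00 A10 r2 Yv].
  apply/ZS => q Sq; have [q5 q5E] := restrict_to_fiber q p`_5 p`_6 p`_7.
  rewrite -q5E; apply: (fiberY_vanish A00 A10 _ Yv) => v Yv' cv; rewrite q5E.
  apply: (ZS _).1 => //; apply: UZ; rewrite totalY_point dE fiber_coordsK.
  by split.
- move=> p; rewrite cE dE /total_mapXY; case=> A00 A10 r2 Xv cv.
  set A0 := p`_5 in A00 A10 r2 Xv cv *; set A1 := p`_6 in A10 r2 Xv cv *.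
  set r := p`_7 in r2 *; set v := fiber_coords p in Xv cv *.
  have rr : A0 * r * r = A0 - A1 by rewrite -mulrA -expr2 r2 mulrC divfK.
  rewrite fiber_coordsK /=; split.
  + by apply/totalY_point; split=> //; [rewrite subr_eq0 eq_sym|apply: fiberX_mapXY].
  + by rewrite scaleY_mapXY expf_neq0.
  (* The parameter [A0 - (A0 - A1)] is [A1], so the composite returns to the same fibre and the same
     branch. *)
  rewrite /total_mapYX fiber_coordsK /= mapXYK // opprB addrC subrK.
  by rewrite -[p]total_pointK; apply: same_point_total.
move=> p; rewrite cE dE /total_mapYX; case=> A00 A10 r2 Yv cv.
set A0 := p`_5 in A00 A10 r2 Yv cv *; set A1 := p`_6 in A10 r2 Yv cv *.
set r := p`_7 in r2 *; set v := fiber_coords p in Yv cv *.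
have rr : A0 * r * r = A1 by rewrite -mulrA -expr2 r2 mulrC divfK.
rewrite fiber_coordsK /=; split.
+ apply/totalX_point; split=> //; first by rewrite -subr_eq0 addrAC subrr sub0r oppr_eq0.
    by rewrite opprB addrC subrK.
  apply: fiberY_mapYX => //.
  by rewrite exprMn r2 expr2 -mulrA mulrCA divff // mulr1.
+ by rewrite scaleX_mapYX expf_neq0.
rewrite /total_mapXY fiber_coordsK /= mapYXK // opprB addrC subrK.
by rewrite -[p]total_pointK; apply: same_point_total.
Qed.

End TotalMaps.

Theorem theorem5p1 (R : realType) :
  [/\ birational weights_total weights_total
        (@totalX R[i]) (@totalY R[i]) (@total_mapXY R[i]),
      birational_inverse weights_total weights_total
        (@totalX R[i]) (@totalY R[i]) (@total_mapXY R[i]) (@total_mapYX R[i])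
    & forall A0 A1 r : R[i],
        A0 != 0 -> A1 != A0 -> r ^+ 2 = (A0 - A1) / A0 ->
        birational weights_fiber weights_fiber
          (fiberX A0 A1) (fiberY A0 (A0 - A1)) (mapXY A0 A1 r) /\
        birational_inverse weights_fiber weights_fiber
          (fiberX A0 A1) (fiberY A0 (A0 - A1))
          (mapXY A0 A1 r) (mapYX A0 (A0 - A1) (A0 * r))].
Proof.
have total := total_birational_inverse R[i].
split=> // [|A0 A1 r A00 A10 r2]; first by exists (@total_mapYX R[i]).
have fib := fiber_birational_inverse A00 A10 r2.
by split=> //; exists (mapYX A0 (A0 - A1) (A0 * r)).
Qed.
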